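(* Let $m\ge 2$ be an integer, let $m=p+q$ with $p,q\ge 1$ integers, and let $f\in L^1_{\mathrm{loc}}(\overline{\mathbb{R}}^m_+)$ be complex-valued. Suppose that the $m$-multiple integral $$\int_0^\infty\int_0^\infty\cdots\int_0^\infty f(t_1,t_2,\ldots,t_m)\,dt_1\,dt_2\cdots dt_m$$ converges regularly, and let $I\in\mathbb{C}$ be its finite limit in Pringsheim's sense. Then: (1) the finite limit $$\lim_{v_{p+1},v_{p+2},\ldots,v_m\to\infty} I(u_1,v_1;\ldots;u_p,v_p;0,v_{p+1};0,v_{p+2};\ldots;0,v_m)=:J(u_1,v_1;u_2,v_2;\ldots;u_p,v_p),$$ $0\le u_k\le v_k<\infty$, $k=1,2,\ldots,p$, exists uniformly in each of the variables $u_1,v_1,\ldots,u_p,v_p$; (2) the function $J$ enjoys the property of additivity in each pair of its variables $(u_k,v_k)$, and vanishes if $u_k=v_k$ or $v_k=0$ for some $1\le k\le p$; (3) $J$ converges regularly in the sense that for every $\varepsilon>0$ there exists some $\rho_3=\rho_3(\varepsilon)>0$ such that $$|J(u_1,v_1;u_2,v_2;\ldots;u_p,v_p)|\le\varepsilon\quad\text{if}\quad \max\{u_1,u_2,\ldots,u_p\}>\rho_3\ \text{ and }\ 0\le u_k\le v_k,\ k=1,2,\ldots,p;$$ (4) the finite limit $$\lim_{v_1,v_2,\ldots,v_p\to\infty}J(0,v_1;0,v_2;\ldots;0,v_p)=I$$ also exists.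
   Context: $\overline{\mathbb{R}}^m_+=[0,\infty)^m$, and $L^1_{\mathrm{loc}}(\overline{\mathbb{R}}^m_+)$ is the set of functions $f:\overline{\mathbb{R}}^m_+\to\mathbb{C}$ that are Lebesgue integrable on every bounded rectangle $[a_1,b_1]\times\cdots\times[a_m,b_m]$ with $0\le a_k<b_k<\infty$. For $0\le u_k\le v_k<\infty$ ($k=1,\ldots,m$) put $$I(u_1,v_1;\ldots;u_m,v_m)=\int_{u_1}^{v_1}\cdots\int_{u_m}^{v_m}f(t_1,\ldots,t_m)\,dt_1\cdots dt_m .$$ Convergence in Pringsheim's sense: the $m$-multiple integral of $f$ converges in Pringsheim's sense to $I\in\mathbb{C}$ if for every $\varepsilon>0$ there exists $\rho_1=\rho_1(\varepsilon)>0$ such that $|I(0,v_1;\ldots;0,v_m)-I|<\varepsilon$ whenever $\min\{v_1,\ldots,v_m\}>\rho_1$. All limits as several variables $v_k\to\infty$ are understood in this sense (the minimum of the variables tends to infinity, independently of one another). Regular convergence: the $m$-multiple integral of $f$ converges regularly if for every $\varepsilon>0$ there exists $\rho_2=\rho_2(\varepsilon)>0$ such that $|I(u_1,v_1;\ldots;u_m,v_m)|<\varepsilon$ whenever $\max\{u_1,\ldots,u_m\}>\rho_2$ and $0\le u_k\le v_k$, $k=1,\ldots,m$. Regular convergence implies convergence in Pringsheim's sense, so $I$ is well defined. Uniform existence of the limit in (1) means: for every $\varepsilon>0$ there is $\rho>0$ such that for all $0\le u_k\le v_k<\infty$ ($k=1,\ldots,p$) and all $v_{p+1},\ldots,v_m$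 with $\min\{v_{p+1},\ldots,v_m\}>\rho$ one has $|I(u_1,v_1;\ldots;u_p,v_p;0,v_{p+1};\ldots;0,v_m)-J(u_1,v_1;\ldots;u_p,v_p)|<\varepsilon$. Additivity in each pair of variables means, e.g. for the pair $(u_1,v_1)$: $J(u_1,v_1;u_2,v_2;\ldots)=J(u_1,\widetilde u_1;u_2,v_2;\ldots)+J(\widetilde u_1,v_1;u_2,v_2;\ldots)$ for all $0\le u_1<\widetilde u_1<v_1$ and $0\le u_k\le v_k$, $k=2,\ldots,p$; and analogously for the other pairs. *)

(* Defs.v *)
From HB Require Import structures.
From mathcomp Require Import all_boot all_order all_algebra.
From mathcomp Require Import complex.
From mathcomp Require Import all_classical all_reals all_analysis.

Set Implicit Arguments.
Unset Strict Implicit.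
Unset Printing Implicit Defensive.

Import Order.TTheory GRing.Theory Num.Theory.

Local Open Scope classical_set_scope.
Local Open Scope ring_scope.

(* Points of R^n are tuples [n.-tuple R], with the product of the Borel
   sigma-algebras as library measurable structure. *)
Section BorelLebesgue.
Variable R : realType.
Local Notation B := (measurableTypeR R).

Definition cons_pair (n : nat) (z : n.-tuple B * B) : n.+1.-tuple B :=
  [the n.+1.-tuple B of z.2 :: z.1].

Lemma measurable_cons_pair (n : nat) : measurable_fun setT (@cons_pair n).
Proof.
exact: (measurable_cons (@measurable_snd _ _ _ _) (@measurable_fst _ _ _ _)).
Qed.

Section ProductCons.
Variables (n : nat) (mu : {measure set (n.-tuple B) -> \bar R}).
Local Notation nu := (mu \x @lebesgue_measure R)%E.

Definition product_cons : set (n.+1.-tuple B) -> \bar R :=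
  pushforward nu (@cons_pair n).

Let mpush A : measurable A -> measurable (@cons_pair n @^-1` A).
Proof.
by move=> mA; rewrite -[X in measurable X]setTI; exact: measurable_cons_pair.
Qed.

Let product_cons0 : product_cons set0 = 0%E.
Proof. by rewrite /product_cons /pushforward preimage_set0 measure0. Qed.

Let product_cons_ge0 A : (0 <= product_cons A)%E.
Proof. exact: (measure_ge0 nu). Qed.

Let product_cons_sigma_additive : semi_sigma_additive product_cons.
Proof.
move=> F mF tF mUF; rewrite /product_cons /pushforward preimage_bigcup.
apply: measure_semi_sigma_additive.
- by move=> k; exact: mpush.
- apply/trivIsetP => /= i j _ _ ij; rewrite -preimage_setI.
  by move/trivIsetP : tF => /(_ _ _ _ _ ij) ->//; rewrite preimage_set0.
- by rewrite -preimage_bigcup; exact: mpush.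
Qed.

HB.instance Definition _ := isMeasure.Build _ _ _ product_cons
  product_cons0 product_cons_ge0 product_cons_sigma_additive.

End ProductCons.

(* The n-fold product of the one-dimensional Lebesgue measure on Borel sets,
   transported from iterated pairs to tuples. *)
Fixpoint borel_lebesgue (n : nat) : {measure set (n.-tuple B) -> \bar R} :=
  match n with
  | 0 => @dirac _ (0.-tuple B) [tuple] R
  | n'.+1 => product_cons (borel_lebesgue n')
  end.

(* Lebesgue measure on R^n, on the complete sigma-algebra of Lebesgue
   (Caratheodory) measurable sets, so that measurability of functions below
   means Lebesgue, not Borel, measurability. *)
Definition lebesgue (n : nat) :=
  @completed_measure_extension _ _ _ (borel_lebesgue n).
HB.instance Definition _ (n : nat) := Measure.on (@lebesgue n).

End BorelLebesgue.
Arguments lebesgue : clear implicits.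

Section MultipleIntegrals.
Variables (R : realType) (n : nat).
Implicit Types (f : n.-tuple R -> R[i]) (u v : n.-tuple R).

Definition box u v : set (n.-tuple R) :=
  [set t | forall k, tnth u k <= tnth t k <= tnth v k].

Definition complex_integrable (D : set (n.-tuple R)) f : Prop :=
  (lebesgue R n).-integrable D (fun t => (complex.Re (f t))%:E) /\
  (lebesgue R n).-integrable D (fun t => (complex.Im (f t))%:E).

Definition complex_integral (D : set (n.-tuple R)) f : R[i] :=
  Complex (\int[lebesgue R n]_(t in D) complex.Re (f t))
          (\int[lebesgue R n]_(t in D) complex.Im (f t)).

(* Functions on the orthant [0, oo[^n are represented by total functions, of
   which only the values on the orthant matter. *)
Definition L1loc f : Prop :=
  forall a b, (forall k, 0 <= tnth a k < tnth b k) ->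
    complex_integrable (box a b) f.

Definition box_integral f u v : R[i] := complex_integral (box u v) f.

Definition ordered_pairs u v : Prop := forall k, 0 <= tnth u k <= tnth v k.

Definition origin : n.-tuple R := [tuple of nseq n 0].

Definition subst_coord u (k : 'I_n) (c : R) : n.-tuple R :=
  [tuple if i == k then c else tnth u i | i < n].

(* rho < min v *)
Definition min_above (rho : R) v : Prop := forall k, rho < tnth v k.

(* rho < max u *)
Definition max_above (rho : R) u : Prop := exists k, rho < tnth u k.

Definition pringsheim_limit (G : n.-tuple R -> R[i]) (l : R[i]) : Prop :=
  forall eps : R, 0 < eps -> exists rho : R, 0 < rho /\
    forall v, min_above rho v -> `|G v - l| < eps%:C%C.

Definition converges_regularly f : Prop :=
  forall eps : R, 0 < eps -> exists rho : R, 0 < rho /\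
    forall u v, ordered_pairs u v -> max_above rho u ->
      `|box_integral f u v| < eps%:C%C.

End MultipleIntegrals.
Arguments origin {R n}.

(* Main.v *)
(* For boxes whose upper corners agree in the first p coordinates, move from one
   upper corner to the other by changing the last q coordinates one at a time:
   by additivity each step costs, up to sign, the integral over a slab whose
   lower edge in that coordinate is large, hence is small by regular convergence.
   So the net defining J is Cauchy uniformly in (u, v), and the remaining claims
   pass to the limit. Additivity of the box integral itself rests on the common
   face of two adjacent boxes lying in a hyperplane, which is Lebesgue-null. *)
Require Import Defs.
From mathcomp Require Import all_boot all_order all_algebra.
From mathcomp Require Import complex.
From mathcomp Require Import all_classical all_reals all_analysis.
From mathcomp Require Import ring.

Set Implicit Arguments.
Unset Strict Implicit.
Unset Printing Implicit Defensive.

Import Order.TTheory GRing.Theory Num.Theory.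

Local Open Scope ring_scope.

(** * Integrals over two sets that overlap in a null set *)

Lemma Rintegral_setU_null d (T : measurableType d) (R : realType)
    (mu : {measure set T -> \bar R}) (A B : set T) (g : T -> R) :
  measurable A -> measurable B ->
  mu.-integrable (A `|` B)%classic (EFin \o g) ->
  mu (A `&` B)%classic = 0%E ->
  \int[mu]_(x in (A `|` B)%classic) g x =
    \int[mu]_(x in A) g x + \int[mu]_(x in B) g x.
Proof.
move=> mA mB ig AB0.
have mBA : measurable (B `\` A)%classic by exact: measurableD.
have mAB : measurable (A `&` B)%classic by exact: measurableI.
have igB : mu.-integrable B (EFin \o g).
  by apply: integrableS ig => //; exact: measurableU.
have UE : (A `|` B = A `|` (B `\` A))%classic.
  apply/seteqP; split=> x /=; last by tauto.
  by have [Ax|Ax] := pselect (A x); tauto.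
(* The sets [A] and [B \ A] are disjoint, and cutting the null set [A ∩ B] out of [B] leaves the
   integral over [B] unchanged. *)
rewrite UE Rintegral_setU //; last 2 first.
- by rewrite -UE.
- by rewrite disj_set2E; apply/eqP; rewrite setIDA setIC -setIDA setDv setI0.
congr (_ + _); rewrite /Rintegral (negligible_integral mAB mB igB AB0).
by rewrite setDIr setDv setU0.
Qed.

Lemma complex_integral_setU_null (R : realType) n (A B : set (n.-tuple R))
    (f : n.-tuple R -> R[i]) :
  measurable (A : set (caratheodory_type (borel_lebesgue R n)^*%mu)) ->
  measurable (B : set (caratheodory_type (borel_lebesgue R n)^*%mu)) ->
  complex_integrable (A `|` B)%classic f ->
  lebesgue R n (A `&` B)%classic = 0%E ->
  complex_integral (A `|` B)%classic f =
    complex_integral A f + complex_integral B f.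
Proof.
move=> mA mB [iRe iIm] AB0; rewrite /complex_integral.
by rewrite !Rintegral_setU_null.
Qed.

(** * Measurability of boxes and nullity of coordinate hyperplanes *)

Section Boxes.
Variables (R : realType) (n : nat).
Local Notation car := (caratheodory_type (borel_lebesgue R n)^*%mu).
Implicit Types u v : n.-tuple R.

Definition hyperplane (k : 'I_n) (c : R) : set (n.-tuple R) :=
  [set t | tnth t k = c]%classic.

Lemma borel_measurable_hyperplane k c :
  measurable (hyperplane k c : set (n.-tuple (measurableTypeR R))).
Proof.
rewrite /hyperplane (_ : [set _ | _]%classic =
  (setT `&` (fun t : n.-tuple (measurableTypeR R) => tnth t k) @^-1` [set c])%classic);
  last by rewrite setTI.
exact: measurable_tnth.
Qed.

Lemma borel_measurable_box u v :
  measurable (box u v : set (n.-tuple (measurableTypeR R))).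
Proof.
rewrite (_ : box u v = \bigcap_(k in [set: 'I_n])
    (setT `&` (fun t : n.-tuple (measurableTypeR R) => tnth t k) @^-1`
      `[tnth u k, tnth v k]%classic)%classic)%classic.
  apply: fin_bigcap_measurable => // k _.
  exact: measurable_tnth.
apply/seteqP; split => t /= h k.
  by split=> //=; rewrite in_itv /=.
by have [_ /=] := h k Logic.I; rewrite in_itv /=.
Qed.

Lemma measurable_box u v : measurable (box u v : set car).
Proof.
exact: (@caratheodory_measurable_mu_ext _ R _ (borel_lebesgue R n) _
  (borel_measurable_box u v)).
Qed.

End Boxes.

(** Induction on the dimension: under [cons_pair] the hyperplane becomes a product set. Its null
    factor is a lower-dimensional hyperplane if [k] is not the head coordinate, and the singleton of
    [c] if it is. The other factor is the whole space, so the convention that 0 times infinity is 0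
    is used. *)
Lemma borel_lebesgue_hyperplane (R : realType) n (k : 'I_n) (c : R) :
  borel_lebesgue R n (hyperplane k c) = 0%E.
Proof.
elim: n k => [[] //|n IHn] k /=.
rewrite /product_cons /pushforward.
case: (unliftP ord0 k) => [j ->|->].
  rewrite (_ : (_ @^-1` _)%classic = (hyperplane j c `*` setT)%classic).
    rewrite product_measure1E //; last exact: borel_measurable_hyperplane.
    by rewrite IHn mul0e.
  by apply/seteqP; split=> -[t x]; rewrite /hyperplane /= tnthS //; case.
rewrite (_ : (_ @^-1` _)%classic = (setT `*` [set c])%classic).
  rewrite product_measure1E //.
  by rewrite [X in (_ * X)%E](lebesgue_measure_set1 c) mule0.
by apply/seteqP; split=> -[t x]; rewrite /hyperplane /= tnth0 //; case.
Qed.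

Lemma lebesgue_hyperplane (R : realType) n (k : 'I_n) (c : R) :
  lebesgue R n (hyperplane k c) = 0%E.
Proof.
rewrite /lebesgue /completed_measure_extension measurable_mu_extE.
  exact: borel_lebesgue_hyperplane.
exact: borel_measurable_hyperplane.
Qed.

Lemma subset_hyperplane_null (R : realType) n (A : set (n.-tuple R))
    (k : 'I_n) (c : R) :
  measurable (A : set (caratheodory_type (borel_lebesgue R n)^*%mu)) ->
  (A `<=` hyperplane k c)%classic -> lebesgue R n A = 0%E.
Proof.
move=> mA AH; apply: (subset_measure0 mA _ AH); last first.
  exact: lebesgue_hyperplane.
exact: (@caratheodory_measurable_mu_ext _ R _ (borel_lebesgue R n) _
  (borel_measurable_hyperplane k c)).
Qed.

(** * Changing one coordinate of a corner *)

Section SubstCoord.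
Variables (R : realType) (n : nat).
Implicit Types u v : n.-tuple R.

Lemma tnth_subst_coord u k c i :
  tnth (subst_coord u k c) i = if i == k then c else tnth u i.
Proof. by rewrite tnth_mktuple. Qed.

Lemma subst_coord_id u k : subst_coord u k (tnth u k) = u.
Proof.
by apply: eq_from_tnth => i; rewrite tnth_subst_coord; case: eqP => [->|].
Qed.

Lemma subst_coordK u k c d :
  subst_coord (subst_coord u k c) k d = subst_coord u k d.
Proof. by apply: eq_from_tnth => i; rewrite !tnth_subst_coord; case: eqP. Qed.

Lemma tnth_origin i : tnth (@origin R n) i = 0.
Proof. by rewrite (tnth_nth 0) nth_nseq if_same. Qed.

Lemma ordered_pairs_substr u v k c :
  ordered_pairs u v -> tnth u k <= c -> ordered_pairs u (subst_coord v k c).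
Proof.
move=> uv uc i; rewrite tnth_subst_coord; case: eqP => [->|_ //].
by rewrite uc andbT; case/andP: (uv k).
Qed.

Lemma ordered_pairs_substl u v k c :
  ordered_pairs u v -> 0 <= c <= tnth v k -> ordered_pairs (subst_coord u k c) v.
Proof. by move=> uv cv i; rewrite tnth_subst_coord; case: eqP => [->|]. Qed.

End SubstCoord.

(** The cut [c] may coincide with an endpoint, so that vanishing on degenerate boxes follows from
    additivity alone. *)
Definition pair_additive (R : realType) n
    (F : n.-tuple R -> n.-tuple R -> R[i]) : Prop :=
  forall u v k c, ordered_pairs u v -> tnth u k <= c <= tnth v k ->
    F u v = F u (subst_coord v k c) + F (subst_coord u k c) v.

(** * Additivity of the box integral *)

Section BoxIntegral.
Variables (R : realType) (n : nat) (f : n.-tuple R -> R[i]).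
Hypothesis f_L1loc : L1loc f.
Implicit Types u v : n.-tuple R.

Lemma L1loc_box_integrable u v : ordered_pairs u v -> complex_integrable (box u v) f.
Proof.
move=> uv.
(* [L1loc] speaks only of boxes with nonempty interior, whereas [box u v] may be degenerate; the
   added 1 makes every edge of the enclosing box nontrivial. *)
pose b := [tuple tnth v i + 1 | i < n].
have [|iRe iIm] := f_L1loc (a := origin) (b := b).
  move=> k; rewrite tnth_origin tnth_mktuple lexx /= ltr_wpDl //.
  by case/andP: (uv k); exact: le_trans.
have sub : (box u v `<=` box origin b)%classic.
  move=> t ht k; rewrite tnth_origin tnth_mktuple.
  case/andP: (uv k) => u0 _; case/andP: (ht k) => ut tv.
  by rewrite (le_trans u0 ut) (le_trans tv) // lerDl.
by split; [apply: integrableS iRe|apply: integrableS iIm] => //; exact: measurable_box.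
Qed.

Lemma box_integral_additive : pair_additive (box_integral f).
Proof.
move=> u v k c uv /andP[uc cv]; rewrite /box_integral.
have UE : (box u v = box u (subst_coord v k c) `|` box (subst_coord u k c) v)%classic.
  apply/seteqP; split => t /=.
    move=> ht; have [tc|ct] := leP (tnth t k) c; [left|right] => i;
      rewrite tnth_subst_coord; case: eqP => [->|_ //].
    - by rewrite tc andbT; case/andP: (ht k).
    - by rewrite (ltW ct) /=; case/andP: (ht k).
  case=> ht i; have := ht i; rewrite tnth_subst_coord; case: eqP => [->|_ //].
  - by move=> /andP[-> /le_trans]; apply.
  - by move=> /andP[/(le_trans uc) -> ->].
rewrite UE complex_integral_setU_null -?UE //; try exact: measurable_box.
  exact: L1loc_box_integrable.
apply: (@subset_hyperplane_null _ _ _ k c).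
  by apply: measurableI; exact: measurable_box.
move=> t [/(_ k) h1 /(_ k) h2]; rewrite tnth_subst_coord eqxx in h1.
rewrite tnth_subst_coord eqxx in h2.
apply/eqP; rewrite eq_le.
by case/andP: h1 => _ ->; case/andP: h2 => ->.
Qed.

End BoxIntegral.

(** * Cauchy estimate for additive functions that are small far out *)

Section PairAdditive.
Variables (R : realType) (n : nat) (F : n.-tuple R -> n.-tuple R -> R[i]).
Hypothesis F_add : pair_additive F.
Implicit Types u v : n.-tuple R.

(** Cutting a degenerate edge at its only point gives [F u v = F u v + F u v]. *)
Lemma pair_additive_eq0 u v k :
  ordered_pairs u v -> tnth u k = tnth v k -> F u v = 0.
Proof.
move=> uv ukv; have := F_add (k := k) (c := tnth u k) uv.
rewrite subst_coord_id ukv subst_coord_id !lexx => /(_ isT).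
by move/eqP; rewrite -subr_eq subrr => /eqP <-.
Qed.

Variables (rho : R) (eps : R[i]).
Hypothesis eps_ge0 : 0 <= eps.
Hypothesis F_small :
  forall u v, ordered_pairs u v -> max_above rho u -> `|F u v| < eps.

(* The difference is, up to sign, the value of F on the slab between the two
   levels, both of which exceed rho. *)
Lemma dist_subst_coord u v k c : ordered_pairs u v -> tnth u k <= c ->
  rho < c -> rho < tnth v k -> `|F u v - F u (subst_coord v k c)| < eps.
Proof.
move=> uv uc rc rv; case/andP: (uv k) => u0 ukv.
have [cv|/ltW vc] := leP c (tnth v k).
  rewrite (F_add (k := k) (c := c) uv) ?uc // addrAC subrr add0r.
  apply: F_small.
    by apply: ordered_pairs_substl; rewrite // cv (le_trans u0).
  by exists k; rewrite tnth_subst_coord eqxx.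
have uv' : ordered_pairs u (subst_coord v k c) by exact: ordered_pairs_substr.
rewrite (F_add (k := k) (c := tnth v k) uv') ?tnth_subst_coord ?eqxx ?ukv //.
rewrite subst_coordK subst_coord_id opprD addNKr normrN.
apply: F_small.
  apply: ordered_pairs_substl => //.
  by rewrite tnth_subst_coord eqxx vc (le_trans u0).
by exists k; rewrite tnth_subst_coord eqxx.
Qed.

Lemma dist_change_upper u v v' : ordered_pairs u v -> ordered_pairs u v' ->
  (forall k, tnth v k = tnth v' k \/ rho < tnth v k /\ rho < tnth v' k) ->
  `|F u v - F u v'| <= eps *+ n.
Proof.
move=> uv uv' vv'.
(* Consecutive hybrids [h j] and [h j.+1] differ at most in coordinate [j]. A coordinate on which
   [v] and [v'] agree costs nothing, any other less than [eps]. *)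
pose h j := [tuple if (i < j)%N then tnth v' i else tnth v i | i < n].
have uh j : ordered_pairs u (h j).
  by move=> i; rewrite tnth_mktuple; case: ifP.
have -> : v = h 0 by apply: eq_from_tnth => i; rewrite tnth_mktuple.
have -> : v' = h n by apply: eq_from_tnth => i; rewrite tnth_mktuple ltn_ord.
suff: forall j, (j <= n)%N -> `|F u (h 0) - F u (h j)| <= eps *+ j by apply.
elim=> [|j IHj] jn; first by rewrite subrr normr0.
pose k := Ordinal jn.
have hS : h j.+1 = subst_coord (h j) k (tnth v' k).
  apply: eq_from_tnth => i; rewrite tnth_subst_coord !tnth_mktuple ltnS.
  by rewrite leq_eqVlt -val_eqE /=; case: eqP => //= ij; congr tnth; apply: val_inj.
have hk : tnth (h j) k = tnth v k by rewrite tnth_mktuple ltnn.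
rewrite mulrSr (le_trans (ler_distD (F u (h j)) _ _)) // lerD //.
  exact/IHj/ltnW.
case: (vv' k) => [vk|[rv rv']].
  by rewrite hS -vk -hk subst_coord_id subrr normr0.
by rewrite hS ltW // dist_subst_coord // ?hk //; case/andP: (uv' k).
Qed.

End PairAdditive.

(** * Completeness: complex sequences and uniform Pringsheim limits *)

Lemma complex_cauchy_limit (R : realType) (a : nat -> R[i]) :
  (forall eps : R, 0 < eps -> exists N, forall n m, (N <= n)%N -> (N <= m)%N ->
    `|a n - a m| <= eps%:C%C) ->
  exists l, forall eps : R, 0 < eps -> exists N, forall n, (N <= n)%N ->
    `|a n - l| < eps%:C%C.
Proof.
move=> a_cauchy.
(* Here [g] stands for the real or the imaginary part; being additive and bounded by the modulus, it
   maps the sequence to a real Cauchy sequence. *)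
have real_limit (g : {additive R[i] -> R}) :
    (forall z, `|g z|%:C%C <= `|z|) ->
    exists l : R, forall eps : R, 0 < eps -> exists N, forall n, (N <= n)%N ->
      `|g (a n) - l| < eps.
  move=> g_le.
  have /R_complete : cauchy (g \o a @ \oo)%classic.
    apply/cauchy_ballP => e e0.
    have [N aN] := a_cauchy _ (divr_gt0 e0 (ltr0n R 2)).
    near_simpl; exists ([set n | (N <= n)%N], [set n | (N <= n)%N])%classic => /=.
      by split; exists N.
    move=> [n m] /= [Nn Nm]; rewrite /ball /= -raddfB -ltcR.
    rewrite (le_lt_trans (g_le _)) // (le_lt_trans (aN _ _ Nn Nm)) //.
    by rewrite ltcR ltr_pdivrMr // ltr_pMr // ltr1n.
  move=> /cvgrPdist_lt gl; exists (limn (g \o a)) => e e0; have [N _ glN] := gl _ e0; exists N => n /glN.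
  by rewrite distrC.
have [x xP] := real_limit (@complex.Re R) (@normc_ge_Re R).
have norm_i : `|'i%C| = 1 :> R[i].
  by rewrite normc_def /= expr0n expr1n add0r sqrtr1.
have norm_real (r : R) : `|r%:C%C| = `|r|%:C%C.
  by rewrite normc_def /= expr0n addr0 sqrtr_sqr.
(* Multiplication by i preserves the modulus and turns the imaginary part, up to sign, into the real
   part. *)
have Im_le (z : R[i]) : `|complex.Im z|%:C%C <= `|z|.
  have := normc_ge_Re (z * 'i%C).
  by rewrite ReiNIm normrN normrM norm_i mulr1.
have [y yP] := real_limit (@complex.Im R) Im_le.
exists (Complex x y) => e e0.
have e2 : 0 < e / 2 by rewrite divr_gt0.
have [N1 aN1] := xP _ e2; have [N2 aN2] := yP _ e2.
exists (maxn N1 N2) => n; rewrite geq_max => /andP[/aN1 h1 /aN2 h2].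
rewrite [a n - _]complexE.
rewrite (le_lt_trans (ler_normD _ _)) // normrM norm_i mul1r.
by rewrite !norm_real !raddfB -rmorphD ltcR [ltRHS](splitr e) ltrD.
Qed.

(** The diagonal points (n, ..., n) eventually exceed every threshold, so the limit can be taken
    along them. The threshold in the conclusion is the Cauchy one, hence independent of [x]; only
    the index on the diagonal depends on [x]. *)
Lemma pringsheim_uniform_complete (R : realType) (T : Type) (D : T -> Prop) q
    (G : T -> q.-tuple R -> R[i]) :
  (forall eps : R, 0 < eps -> exists rho : R, 0 < rho /\ forall x w w',
    D x -> min_above rho w -> min_above rho w' -> `|G x w - G x w'| <= eps%:C%C) ->
  exists J : T -> R[i], forall eps : R, 0 < eps -> exists rho : R, 0 < rho /\
    forall x w, D x -> min_above rho w -> `|G x w - J x| < eps%:C%C.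
Proof.
move=> G_cauchy.
pose diag (n : nat) : q.-tuple R := [tuple n%:R | _ < q].
have diag_above (rho : R) : exists N, forall n, (N <= n)%N -> min_above rho (diag n).
  exists (Num.truncn rho).+1 => n Nn k; rewrite tnth_mktuple.
  by rewrite (lt_le_trans (truncnS_gt rho)) // ler_nat.
have /choice[J JP] : forall x, exists l, D x -> forall eps : R, 0 < eps ->
    exists N, forall n, (N <= n)%N -> `|G x (diag n) - l| < eps%:C%C.
  (* Choice needs a value for every [x]; outside [D] it is the arbitrary value 0. *)
  move=> x; have [Dx|] := pselect (D x); last by exists 0.
  have [|l lP] := @complex_cauchy_limit R (fun n => G x (diag n)).
    move=> e /G_cauchy[rho [_ h]]; have [N NP] := diag_above rho.
    by exists N => n m Nn Nm; apply: h => //; exact: NP.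
  by exists l.
exists J => e e0; have e2 : 0 < e / 2 by rewrite divr_gt0.
have [rho [rho0 h]] := G_cauchy _ e2; exists rho; split=> // x w Dx wrho.
have [N1 N1P] := diag_above rho; have [N2 N2P] := JP x Dx _ e2.
pose n := maxn N1 N2.
rewrite (le_lt_trans (ler_distD (G x (diag n)) _ _)) //.
rewrite [e]splitr rmorphD /= ler_ltD //.
  by apply: h => //; apply: N1P; exact: leq_maxl.
by apply: N2P; exact: leq_maxr.
Qed.

(** * Splitting the variables into two blocks *)

Section CatTuples.
Variables (R : realType) (p q : nat).
Implicit Types (u v : p.-tuple R) (y z : q.-tuple R).

Lemma ordered_pairs_cat u v y z : ordered_pairs u v -> ordered_pairs y z ->
  ordered_pairs [tuple of u ++ y] [tuple of v ++ z].
Proof.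
by move=> uv uz k; case: (split_ordP k) => j ->;
  rewrite ?tnth_lshift ?tnth_rshift.
Qed.

Lemma subst_coord_cat u y k c :
  subst_coord [tuple of u ++ y] (lshift q k) c =
  [tuple of subst_coord u k c ++ y].
Proof.
apply: eq_from_tnth => i; rewrite tnth_subst_coord.
case: (split_ordP i) => j ->; last by rewrite !tnth_rshift eq_rlshift.
by rewrite !tnth_lshift tnth_subst_coord eq_lshift.
Qed.

Lemma cat_origin : [tuple of @origin R p ++ @origin R q] = origin.
Proof.
apply: eq_from_tnth => i; rewrite tnth_origin.
by case: (split_ordP i) => j ->; rewrite ?tnth_lshift ?tnth_rshift tnth_origin.
Qed.

Lemma ordered_pairs_origin rho v : 0 < rho -> min_above rho v -> ordered_pairs origin v.
Proof. by move=> rho0 vrho k; rewrite tnth_origin lexx /= ltW // (lt_trans rho0). Qed.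

Lemma min_aboveW rho rho' v : rho <= rho' -> min_above rho' v -> min_above rho v.
Proof. by move=> le_rho vrho k; exact: le_lt_trans (vrho k). Qed.

Lemma min_above_cat rho v z : min_above rho v -> min_above rho z ->
  min_above rho [tuple of v ++ z].
Proof.
by move=> vrho vrho' k; case: (split_ordP k) => j ->;
  rewrite ?tnth_lshift ?tnth_rshift.
Qed.

End CatTuples.

Lemma exists_min_above (R : realType) n (rho : R) : exists v : n.-tuple R, min_above rho v.
Proof. by exists [tuple rho + 1 | _ < n] => k; rewrite tnth_mktuple ltrDl. Qed.

(** If [x] and [y] differed, their distance would itself be an admissible [eps], and would be less
    than itself. *)
Lemma eq_of_close (R : realType) (x y : R[i]) :
  (forall eps : R, 0 < eps -> `|x - y| < eps%:C%C) -> x = y.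
Proof.
move=> xy; apply/eqP; rewrite -subr_eq0 -normr_eq0.
have := normr_ge0 (x - y); rewrite le0r => /orP[//|].
rewrite normc_def ltcR => /xy.
by rewrite normc_def ltcR ltxx.
Qed.

Theorem theorem4p1 (R : realType) (p q : nat) (p_ge1 : (1 <= p)%N)
    (q_ge1 : (1 <= q)%N) (f : (p + q).-tuple R -> R[i]) (I : R[i])
    (f_L1loc : L1loc f) (f_reg : converges_regularly f)
    (f_lim : pringsheim_limit (fun v => box_integral f origin v) I) :
  exists J : p.-tuple R -> p.-tuple R -> R[i],
    (* (1) uniform existence of the limit defining J *)
    (forall eps : R, 0 < eps -> exists rho : R, 0 < rho /\
       forall (u v : p.-tuple R) (w : q.-tuple R),
         ordered_pairs u v -> min_above rho w ->
         `|box_integral f [tuple of u ++ origin] [tuple of v ++ w] - J u v|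
           < eps%:C%C) /\
    (* (2) additivity in each pair of variables, and vanishing *)
    (forall (u v : p.-tuple R) (k : 'I_p) (c : R), ordered_pairs u v ->
       tnth u k < c < tnth v k ->
       J u v = J u (subst_coord v k c) + J (subst_coord u k c) v) /\
    (forall u v : p.-tuple R, ordered_pairs u v ->
       (exists k, tnth u k = tnth v k \/ tnth v k = 0) -> J u v = 0) /\
    (* (3) regular convergence of J *)
    (forall eps : R, 0 < eps -> exists rho : R, 0 < rho /\
       forall u v : p.-tuple R, ordered_pairs u v -> max_above rho u ->
         `|J u v| <= eps%:C%C) /\
    (* (4) the limit of J *)
    pringsheim_limit (fun v => J origin v) I.
Proof.
pose F := box_integral f; have F_add := box_integral_additive f_L1loc.
pose G (x : p.-tuple R * p.-tuple R) (w : q.-tuple R) :=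
  F [tuple of x.1 ++ origin] [tuple of x.2 ++ w].
have [|J0 J0P] :=
    @pringsheim_uniform_complete R _ (fun x => ordered_pairs x.1 x.2) q G.
  move=> e e0; have c0 : 0 < (p + q)%:R :> R by rewrite ltr0n addn_gt0 p_ge1.
  (* The division by [p + q] offsets the factor in [dist_change_upper], which counts all
     coordinates, including the first [p] that stay fixed. *)
  have [rho [rho0 Fe]] := f_reg _ (divr_gt0 e0 c0).
  exists rho; split=> // -[u v] w w' /= uv wrho wrho'.
  have oc w0 : min_above rho w0 ->
      ordered_pairs [tuple of u ++ origin] [tuple of v ++ w0].
    by move=> w0rho; apply: ordered_pairs_cat => //; exact: ordered_pairs_origin w0rho.
  have -> : e%:C%C = (e / (p + q)%:R)%:C%C *+ (p + q).
    by rewrite -rmorphMn /= -mulr_natr divfK // gt_eqF.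
  apply: (dist_change_upper F_add _ Fe); rewrite ?lecR.
  - exact/ltW/divr_gt0.
  - exact: oc.
  - exact: oc.
  move=> k; case: (split_ordP k) => j ->.
    by left; rewrite !tnth_lshift.
  by right; rewrite !tnth_rshift.
pose J u v := J0 (u, v).
have JP (eps : R) : 0 < eps -> exists rho : R, 0 < rho /\
    forall u v w, ordered_pairs u v -> min_above rho w ->
      `|F [tuple of u ++ origin] [tuple of v ++ w] - J u v| < eps%:C%C.
  move=> /J0P[rho [rho0 h]]; exists rho; split=> // u v w uv wrho.
  exact: (h (u, v)).
have Jlim u v : ordered_pairs u v -> forall eps : R, 0 < eps ->
    exists w : q.-tuple R, ordered_pairs origin w /\
      `|F [tuple of u ++ origin] [tuple of v ++ w] - J u v| < eps%:C%C.
  move=> uv e /JP[rho [rho0 h]]; have [w wrho] := exists_min_above q rho.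
  by exists w; split; [exact: ordered_pairs_origin wrho|exact: h].
(* One [w] beyond the uniform threshold serves all three corner pairs; additivity of [F] at this [w]
   leaves three errors, each below [e / 3]. *)
have J_add : pair_additive J.
  move=> u v k c uv ucv; apply: eq_of_close => e e0.
  have e3 : 0 < e / 3 by rewrite divr_gt0.
  have [rho [rho0 h]] := JP _ e3.
  have [w wrho] := exists_min_above q rho.
  have ow := ordered_pairs_origin rho0 wrho.
  have c0 : 0 <= c by case/andP: ucv => uc _; case/andP: (uv k) => /le_trans/(_ uc).
  have uvr : ordered_pairs u (subst_coord v k c).
    by apply: ordered_pairs_substr => //; case/andP: ucv.
  have uvl : ordered_pairs (subst_coord u k c) v.
    by apply: ordered_pairs_substl => //; rewrite c0; case/andP: ucv.
  have Fuv := F_add _ _ (lshift q k) c (ordered_pairs_cat uv ow).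
  rewrite !tnth_lshift !subst_coord_cat in Fuv.
  have {}Fuv := Fuv ucv.
  set a := F [tuple of u ++ origin] [tuple of v ++ w].
  set b := F [tuple of u ++ origin] [tuple of subst_coord v k c ++ w].
  set d := F [tuple of subst_coord u k c ++ origin] [tuple of v ++ w].
  have -> : J u v - (J u (subst_coord v k c) + J (subst_coord u k c) v) =
      (b - J u (subst_coord v k c)) + (d - J (subst_coord u k c) v) - (a - J u v).
    by rewrite (_ : a = b + d) //; ring.
  have -> : e%:C%C = (e / 3)%:C%C + (e / 3)%:C%C + (e / 3)%:C%C.
    by rewrite -!rmorphD /=; congr (_%:C%C); field.
  rewrite (le_lt_trans (ler_normB _ _)) // ltrD ?h //.
  by rewrite (le_lt_trans (ler_normD _ _)) // ltrD ?h.
exists J; split; first exact: JP.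
split; first by move=> u v k c uv /andP[uc cv]; apply: J_add => //; rewrite !ltW.
split.
  move=> u v uv [k ukv]; apply: (pair_additive_eq0 J_add uv (k := k)).
  (* If [v] vanishes in coordinate [k], then so does [u], which brings this case back to equal
     endpoints. *)
  case: ukv => // vk; have := uv k; rewrite vk => /andP[u0 u0'].
  by apply/eqP; rewrite eq_le u0 u0'.
split.
  move=> e e0; have e2 : 0 < e / 2 by rewrite divr_gt0.
  have [rho [rho0 Fe]] := f_reg _ e2.
  (* A large coordinate of [u] is also one of [u ++ origin], so regular convergence bounds the
     integrals approximating [J u v] whatever [w] is. *)
  exists rho; split=> // u v uv [k uk].
  have [w [ow Jw]] := Jlim u v uv _ e2.
  rewrite -[J u v](subKr (F [tuple of u ++ origin] [tuple of v ++ w])).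
  rewrite (le_trans (ler_normB _ _)) // [e]splitr rmorphD /= ltW // ltrD //.
  apply: Fe; first exact: ordered_pairs_cat.
  by exists (lshift q k); rewrite tnth_lshift.
move=> e e0; have e2 : 0 < e / 2 by rewrite divr_gt0.
have [r1 [r10 h1]] := JP _ e2; have [r2 [r20 h2]] := f_lim _ e2.
(* The threshold [r1] constrains only [w], since the convergence to [J] is uniform in [v]. Hence [v]
   need only exceed [r2], while [w] is taken beyond both. *)
exists r2; split=> // v vr2.
have [w wr] := exists_min_above q (Num.max r1 r2).
have wr1 : min_above r1 w by apply: min_aboveW wr; rewrite le_max lexx.
have wr2 : min_above r2 w by apply: min_aboveW wr; rewrite le_max lexx orbT.
have := h1 _ _ _ (ordered_pairs_origin r20 vr2) wr1; rewrite cat_origin => h1v.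
rewrite (le_lt_trans (ler_distD (F origin [tuple of v ++ w]) _ _)) //.
rewrite [e]splitr rmorphD /= ltrD //; first by rewrite distrC.
by apply: h2; exact: min_above_cat.
Qed.
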